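(* Let $(X_t)_{t\in\mathbb{R}}$ be a real-valued Lévy process (possibly with both upward and downward jumps) with $\mathbb{E}\,X_1<0$, let $Q_t:=\sup_{s\leqslant t}(X_t-X_s)$, $t\in\mathbb{R}$, be the associated stationary workload process (the Lévy process reflected from below at $0$), and assume $0<\mathrm{Var}(Q_0)<\infty$. Then the correlation function $$r(t):=\frac{\mathrm{Cov}(Q_0,Q_t)}{\sqrt{\mathrm{Var}(Q_0)\,\mathrm{Var}(Q_t)}},\qquad t\geqslant 0,$$ is non-negative, non-increasing and convex on $[0,\infty)$.
   Context: A Lévy process indexed by $\mathbb{R}$ is a càdlàg process with stationary independent increments and $X_0=0$. The process $(Q_t)_{t\in\mathbb{R}}$ is stationary, and for $t\geqslant 0$ it satisfies $Q_t=X_t+\max\{Q_0,-\inf_{0\leqslant u\leqslant t}X_u\}$. *)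

(* Defs.v *)
From HB Require Import structures.
#[export] Set Warnings "-notation-overridden,-ambiguous-paths".
From mathcomp Require Export all_boot all_order all_algebra.
From mathcomp Require Export all_classical all_reals all_analysis.
Export Order.TTheory GRing.Theory Num.Theory.
Export numFieldNormedType.Exports.

Set Implicit Arguments.
Unset Strict Implicit.
Unset Printing Implicit Defensive.

Local Open Scope classical_set_scope.
Local Open Scope ring_scope.

Definition cadlag (R : realType) (f : R -> R) : Prop :=
  right_continuous f /\ forall t : R, cvg (f s @[s --> t^'-]).

(* For finitely many variables, the product rule over the full family implies
   the one over every subfamily (take B i = setT). *)
Definition mutually_independent d (T : measurableType d) (R : realType)
    (P : probability T R) (n : nat) (Y : 'I_n -> T -> R) : Prop :=
  forall B : 'I_n -> set R, (forall i, measurable (B i)) ->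
    P [set w | forall i, B i (Y i w)] = (\prod_(i < n) P (Y i @^-1` B i))%E.

Definition same_law d (T : measurableType d) (R : realType)
    (P : probability T R) (Y Z : T -> R) : Prop :=
  forall B : set R, measurable B -> P (Y @^-1` B) = P (Z @^-1` B).

(* Two-sided: the time index ranges over all of R.  The path properties are
   required for every sample point, not merely almost surely. *)
Record levy_process d (T : measurableType d) (R : realType)
    (P : probability T R) (X : R -> {RV P >-> R}) : Prop := LevyProcess {
  levy_start : forall w, X 0 w = 0;
  levy_cadlag : forall w, cadlag (fun t => X t w);
  levy_stationary : forall s t h : R, s <= t ->
    same_law P (X (t + h) \- X (s + h)) (X t \- X s);
  levy_independent : forall (n : nat) (t : nat -> R),
    (forall i, t i <= t i.+1) ->
    mutually_independent P (fun i : 'I_n => X (t i.+1) \- X (t i))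
}.

(* The real-valued sup is 0 on sets that are unbounded above; for a Levy
   process with negative mean this concerns only a null set of sample points. *)
Definition workload d (T : measurableType d) (R : realType)
    (P : probability T R) (X : R -> {RV P >-> R}) (t : R) (w : T) : R :=
  sup [set X t w - X s w | s in [set s | s <= t]].

Definition correlation d (T : measurableType d) (R : realType)
    (P : probability T R) (Y Z : T -> R) : R :=
  fine (covariance P Y Z) / Num.sqrt (fine 'V_P[Y] * fine 'V_P[Z]).

(* Main.v *)
From HB Require Import structures.
Require Import Defs.
From mathcomp Require Import measurable_realfun.
From mathcomp Require Import ring lra.

Set Implicit Arguments.
Unset Strict Implicit.
Unset Printing Implicit Defensive.

Local Open Scope classical_set_scope.
Local Open Scope ring_scope.

(* Write Q_(u+t) = A + (Q_u - M)^+ with M = - inf_(0<=v<=t) (X_(u+v) - X_u) and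
   A = X_(u+t) - X_u + M; the pair (A, M) is independent of the past of u and
   its law does not depend on u.  Hence, with k_u(m) = E[Q_0 (Q_u - m)^+],
     E[Q_0 Q_(u+t)] = E[Q_0] E[A] + E[k_u(M)].
   Since Q_u and Q_0 have the same law, the rearrangement inequality
   E[Q_0 D(Q_u)] <= E[Q_0 D(Q_0)] for nondecreasing D, applied to
   D(x) = (x - m)^+ and to D(x) = (x - m)^+ - (x - m')^+, shows that k_0 - k_u is
   nonnegative and nonincreasing.  As M is nondecreasing in t, the decrease
   E[Q_0 Q_t] - E[Q_0 Q_(u+t)] is nonnegative and nonincreasing in t, which gives
   monotonicity and convexity; nonnegativity is Chebyshev's association
   inequality.
   That Q is almost surely a genuine supremum follows from the positivity of its
   variance: unboundedness is a tail event, so it has probability 0 or 1, and in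
   the latter case Q = 0 almost surely. *)

(** * Laws and independence of random paths *)

Section PathSpace.
Context (R : realType) (I : eqType).

(** Finite-dimensional cylinder sets; [B] is total, but only its values on [l] matter. *)
Definition box (l : seq I) (B : I -> set R) : set (I -> R) :=
  [set f | forall i, i \in l -> B i (f i)].

Definition boxes : set (set (I -> R)) :=
  [set E | exists l B, (forall i, measurable (B i)) /\ E = box l B].

Lemma boxes_setI_closed : setI_closed boxes.
Proof.
move=> _ _ [l1 [B1 [mB1 ->]]] [l2 [B2 [mB2 ->]]].
exists (l1 ++ l2), (fun i => (if i \in l1 then B1 i else setT) `&`
                             (if i \in l2 then B2 i else setT)); split.
  by move=> i; apply: measurableI; case: ifP.
apply/seteqP; split=> f /=.
  move=> [f1 f2] i _; split; case: ifP => // il; [exact: f1|exact: f2].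
move=> H; split=> i il; have := H i; rewrite mem_cat il ?orbT => /(_ isT) [];
  by [].
Qed.

Lemma boxesT : boxes setT.
Proof.
exists [::], (fun=> setT); split=> //; apply/seteqP; split=> f //=.
Qed.

End PathSpace.

(** All functions, with the product sigma-algebra. No path regularity is built in, so the suprema
    below have to run over rational times to be measurable. *)
Notation pathspace R I := (g_sigma_algebraType (@boxes R I)).

Section PathMeasurability.
Context (R : realType) (I : eqType).

Lemma measurable_box (l : seq I) (B : I -> set R) :
  (forall i, measurable (B i)) -> measurable (box l B : set (pathspace R I)).
Proof. by move=> mB; apply: sub_sigma_algebra; exists l, B. Qed.

Lemma measurable_coord (i : I) :
  measurable_fun setT (fun f : pathspace R I => f i : R).
Proof.
move=> _ B mB; rewrite setTI.
have -> : (fun f : pathspace R I => f i : R) @^-1` B = box [:: i] (fun=> B).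
  apply/seteqP; split=> f /=; first by move=> Bf j; rewrite inE => /eqP ->.
  by move=> /(_ i); apply; rewrite inE.
exact: measurable_box.
Qed.

Lemma measurable_path d (T : measurableType d) (F : T -> pathspace R I) :
  (forall i, measurable_fun setT (fun x => F x i : R)) -> measurable_fun setT F.
Proof.
move=> mF; apply: (@measurability _ _ _ (pathspace R I) setT F (@boxes R I)) => //.
move=> _ [_ [l [B [mB ->]]] <-]; rewrite setTI.
have -> : F @^-1` box l B = \bigcap_(i in [set` l]) ((fun x => F x i) @^-1` B i).
  by apply/seteqP; split.
apply: fin_bigcap_measurable => // i _.
by rewrite -[X in measurable X]setTI; exact: mF.
Qed.

End PathMeasurability.

Section PathLaw.
Context d (T : measurableType d) (R : realType) (P : probability T R).

(** Boxes are stable under intersection and generate the sigma-algebra, so the finite-dimensional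
    laws determine the law. *)
Lemma path_law_unique (I : eqType) (Y Z : {mfun T >-> pathspace R I}) :
  (forall l B, (forall i, measurable (B i)) ->
     P (Y @^-1` box l B) = P (Z @^-1` box l B)) ->
  forall C : set (pathspace R I), measurable C -> P (Y @^-1` C) = P (Z @^-1` C).
Proof.
move=> YZ C mC; rewrite -[LHS]/(distribution P Y C) -[RHS]/(distribution P Z C).
apply: (@measure_unique _ R (pathspace R I) (@boxes R I) (fun=> setT) _ _ _ _
  (distribution P Y) (distribution P Z)) => //.
- exact: boxes_setI_closed.
- by move=> _; exact: boxesT.
- by rewrite bigcup_const.
- by move=> A [l [B [mB ->]]]; exact: YZ.
- by move=> _ /=; rewrite probability_setT ltry.
Qed.

Lemma indep_path_event (I : eqType) (Y : {mfun T >-> pathspace R I}) (E : set T) :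
  measurable E ->
  (forall l B, (forall i, measurable (B i)) ->
     P ((Y @^-1` box l B) `&` E) = (P (Y @^-1` box l B) * P E)%E) ->
  forall C : set (pathspace R I), measurable C ->
    P ((Y @^-1` C) `&` E) = (P (Y @^-1` C) * P E)%E.
Proof.
move=> mE YE C mC.
(* Both sides are finite measures in [C]: the law of [Y] restricted to [E], and the law of [Y]
   scaled by [P E]. *)
pose m1 := pushforward (mrestr P mE) Y.
pose e : {nonneg R} := NngNum (fine_ge0 (measure_ge0 P E)).
pose m2 := mscale e (distribution P Y).
have -> : P ((Y @^-1` C) `&` E) = m1 C by [].
have e_ : (e%:num%:E)%E = P E by rewrite /= fineK // fin_num_measure.
have -> : (P (Y @^-1` C) * P E)%E = m2 C by rewrite /m2 /mscale e_ muleC.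
apply: (@measure_unique _ R (pathspace R I) (@boxes R I) (fun=> setT) _ _ _ _
  m1 m2) => //.
- exact: boxes_setI_closed.
- by move=> _; exact: boxesT.
- by rewrite bigcup_const.
- move=> A [l [B [mB ->]]].
  rewrite /m1 /m2 /= /mscale e_ [RHS]muleC; exact: YE.
- move=> _; rewrite -[X in (X < _)%E]/(P (setT `&` E)) setTI.
  by apply: (@le_lt_trans _ _ 1%E); [exact: probability_le1|exact: ltry].
Qed.

(** Extends the product rule from boxes to measurable sets in one factor at a time. *)
Lemma indep_paths (I J : eqType) (Y : {mfun T >-> pathspace R I})
    (Z : {mfun T >-> pathspace R J}) :
  (forall l B l' B', (forall i, measurable (B i)) ->
     (forall j, measurable (B' j)) ->
     P ((Y @^-1` box l B) `&` (Z @^-1` box l' B')) =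
     (P (Y @^-1` box l B) * P (Z @^-1` box l' B'))%E) ->
  forall (C : set (pathspace R I)) (D : set (pathspace R J)),
    measurable C -> measurable D ->
    P ((Y @^-1` C) `&` (Z @^-1` D)) = (P (Y @^-1` C) * P (Z @^-1` D))%E.
Proof.
move=> YZ C D mC mD; apply: indep_path_event => //.
  exact: measurable_funPTI.
move=> l B mB; rewrite setIC muleC; apply: indep_path_event => //.
  by apply: measurable_funPTI; exact: measurable_box.
by move=> l' B' mB'; rewrite setIC muleC; exact: YZ.
Qed.

End PathLaw.

(** * Tonelli's theorem for independent random elements *)

Section IndependentFubini.
Local Open Scope ereal_scope.
Context d (T : measurableType d) (R : realType) (P : probability T R).
Context d1 (S1 : measurableType d1) d2 (S2 : measurableType d2).
Variables (Y : {mfun T >-> S1}) (Z : {mfun T >-> S2}) (F : S1 * S2 -> \bar R).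
Hypothesis mF : measurable_fun [set: S1 * S2] F.
Hypothesis F0 : forall x, 0 <= F x.

Let partialE (y : S2) :
  \int[distribution P Y]_x F (x, y) = \int[P]_w F (Y w, y).
Proof.
rewrite ge0_integral_distribution//.
exact: (measurableT_comp mF (pair2_measurable y)).
Qed.

Lemma measurable_partial_integral :
  measurable_fun setT (fun y => \int[P]_w F (Y w, y)).
Proof.
rewrite (_ : (fun y => _) = fubini_G (distribution P Y) F).
  exact: measurable_fun_fubini_tonelli_G.
by apply/funext => y; rewrite /fubini_G partialE.
Qed.

(** Independence makes the law of the pair the product of the two laws, to which Tonelli applies. *)
Lemma indep_fubini :
  (forall C D, measurable C -> measurable D ->
     P ((Y @^-1` C) `&` (Z @^-1` D)) = P (Y @^-1` C) * P (Z @^-1` D)) ->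
  \int[P]_w F (Y w, Z w) = \int[P]_w' \int[P]_w F (Y w, Z w').
Proof.
move=> YZ.
have mW : measurable_fun setT (fun w => (Y w, Z w)).
  exact: measurable_fun_pair.
pose W : {mfun T >-> (S1 * S2)%type} := mfun_Sub (mem_set mW).
transitivity (\int[distribution P W]_z F z).
  by rewrite ge0_integral_distribution.
rewrite (eq_measure_integral (distribution P Y \x distribution P Z)); last first.
  by move=> A mA _; apply/esym/product_measure_unique.
rewrite fubini_tonelli2// ge0_integral_distribution//.
- by apply: eq_integral => w _ /=; rewrite /fubini_G partialE.
- exact: measurable_fun_fubini_tonelli_G.
- by move=> y; exact: integral_ge0.
Qed.

End IndependentFubini.

(** * Increments before and after a fixed time *)

(** Puts finitely many past times -|v| and future times |v| on one nondecreasing grid with 0 at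
    position [k], since [levy_independent] speaks of consecutive increments. *)
Lemma time_grid (R : realType) (l l' : seq R) :
  exists (t : nat -> R) (k : nat) (i i' : R -> nat),
    [/\ forall j, t j <= t j.+1, t k = 0,
        forall v, v \in l -> (i v <= k)%N /\ t (i v) = - `|v| &
        forall v, v \in l' -> (k <= i' v)%N /\ t (i' v) = `|v|].
Proof.
pose L : seq R := sort <=%R (0 :: [seq - `|v| | v <- l] ++ [seq `|v| | v <- l']).
have sL : sorted <=%R L by exact: sort_le_sorted.
have L0 : 0 \in L by rewrite mem_sort inE eqxx.
have Ll v : v \in l -> - `|v| \in L.
  move=> vl; rewrite mem_sort inE mem_cat; apply/orP; right; apply/orP; left.
  by apply/mapP; exists v.
have Ll' v : v \in l' -> `|v| \in L.
  move=> vl; rewrite mem_sort inE mem_cat; apply/orP; right; apply/orP; right.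
  by apply/mapP; exists v.
(* Beyond the end of the sorted list the grid stays at its last entry, so that it is nondecreasing
   on all of [nat]. *)
pose t (j : nat) : R := nth 0 L (minn j (size L).-1).
have tE (v : R) : v \in L -> t (index v L) = v.
  move=> vL; rewrite /t (minn_idPl _) ?nth_index//.
  by rewrite -ltnS prednK ?index_mem//; case: (L) vL.
have le_index (x y : R) : x \in L -> y \in L -> x <= y -> (index x L <= index y L)%N.
  move=> xL yL xy; rewrite leqNgt; apply/negP => yx.
  have := sorted_leq_index le_trans lexx sL y x yL xL (ltnW yx).
  move=> yx2; have E : x = y by apply: le_anti; rewrite xy; exact: yx2.
  by move: yx; rewrite E ltnn.
exists t, (index 0 L), (fun v => index (- `|v|) L), (fun v => index `|v| L).
split.
- move=> j; have L_gt0 : (0 < size L)%N by case: (L) L0.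
  have ltL i : (minn i (size L).-1 < size L)%N.
    by rewrite (leq_ltn_trans (geq_minr _ _))// prednK.
  apply: (sorted_leq_nth le_trans lexx 0 sL); [exact: ltL|exact: ltL|].
  by rewrite leq_min !geq_min leqnSn leqnn orbT.
- exact: tE.
- move=> v vl; rewrite tE ?Ll//; split=> //.
  by apply: le_index; rewrite ?Ll// oppr_le0.
- by move=> v vl; rewrite tE ?Ll'//; split=> //; apply: le_index; rewrite ?Ll'.
Qed.

Section Increments.
Context d (T : measurableType d) (R : realType) (P : probability T R).
Variables (X : R -> {RV P >-> R}) (levyX : levy_process X).

(** The absolute value lets the whole line index the times up to [s]; the supremum of this path
    defines the workload at [s]. *)
Definition past (s : R) (w : T) : pathspace R R := fun v => X s w - X (s - `|v|) w.

Definition future (s : R) (w : T) : pathspace R R := fun v => X (s + `|v|) w - X s w.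

Lemma measurable_past s : measurable_fun setT (past s).
Proof. by apply: measurable_path => v; exact: measurable_funB. Qed.

Lemma measurable_future s : measurable_fun setT (future s).
Proof. by apply: measurable_path => v; exact: measurable_funB. Qed.

HB.instance Definition _ s :=
  isMeasurableFun.Build _ _ _ _ (past s) (measurable_past s).

HB.instance Definition _ s :=
  isMeasurableFun.Build _ _ _ _ (future s) (measurable_future s).

Section Grid.
Variables (t : nat -> R) (k : nat).
Hypothesis t_nd : forall i, t i <= t i.+1.

Definition incr (s : R) (i : nat) (w : T) : R := X (t i.+1 + s) w - X (t i + s) w.

Lemma measurable_incr s i : measurable_fun setT (incr s i).
Proof. exact: measurable_funB. Qed.

(** Independence factors the event over the grid shifted by [s], and stationarity moves each factor
    back to shift 0. The right side is free of [s], which gives both the invariance and the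
    independence below. *)
Lemma incr_nat_box s n (B : nat -> set R) : (forall i, measurable (B i)) ->
  P [set w | forall i, (i < n)%N -> B i (incr s i w)] =
  (\prod_(i < n) P (incr 0 i @^-1` B i))%E.
Proof.
move=> mB.
have ts i : t i + s <= t i.+1 + s by rewrite lerD2r.
have := @levy_independent _ _ _ _ _ levyX n _ ts (fun i => B (val i))
  (fun i => mB _).
rewrite (_ : [set w | _] = [set w | forall i, (i < n)%N -> B i (incr s i w)]).
  move=> ->; apply: eq_bigr => i _.
  rewrite (levy_stationary levyX s (t_nd i) (mB i)).
  by congr (P _); apply/funext => w; rewrite /incr /= /preimage /= !addr0.
apply/seteqP; split => w /= H i; first by move=> ni; exact: (H (Ordinal ni)).
exact: H.
Qed.

Definition incr_before (s : R) (w : T) : pathspace R 'I_k := fun j => incr s j w.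

Definition incr_after (s : R) (w : T) : pathspace R nat := fun j => incr s (k + j) w.

Lemma measurable_incr_before s : measurable_fun setT (incr_before s).
Proof. by apply: measurable_path => v; exact: measurable_incr. Qed.

Lemma measurable_incr_after s : measurable_fun setT (incr_after s).
Proof. by apply: measurable_path => v; exact: measurable_incr. Qed.

HB.instance Definition _ s :=
  isMeasurableFun.Build _ _ _ _ (incr_before s) (measurable_incr_before s).

HB.instance Definition _ s :=
  isMeasurableFun.Build _ _ _ _ (incr_after s) (measurable_incr_after s).

(** Constraints on [l] become constraints on all grid indices, trivial where [l] says nothing. *)
Let before_set (l : seq 'I_k) (B : 'I_k -> set R) (i : nat) : set R :=
  if insub i is Some j then if j \in l then B j else setT else setT.

Let after_set (l : seq nat) (B : nat -> set R) (i : nat) : set R :=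
  if (k <= i)%N && ((i - k)%N \in l) then B (i - k)%N else setT.

(** Strictly above every constrained index [k + j], with [j] in [l]. *)
Let after_bound (l : seq nat) := (k + (\max_(i <- l) i).+1)%N.

Let incr_beforeE s l B n : (k <= n)%N ->
  incr_before s @^-1` box l B =
  [set w | forall i, (i < n)%N -> before_set l B i (incr s i w)].
Proof.
move=> kn; apply/seteqP; split => w H.
  move=> i _; rewrite /before_set; case: insubP => //= j _ <-.
  by case: ifPn => // jl; exact: H.
move=> j jl; have := H j (leq_trans (ltn_ord j) kn).
by rewrite /before_set valK jl.
Qed.

Let incr_afterE s l B :
  incr_after s @^-1` box l B =
  [set w | forall i, (i < after_bound l)%N -> after_set l B i (incr s i w)].
Proof.
apply/seteqP; split => w H.
  move=> i _; rewrite /after_set; case: ifPn => // /andP[ki il].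
  by have := H _ il; rewrite /incr_after subnKC.
move=> j jl; have := H (k + j)%N.
rewrite /after_set leq_addr /= addnC addnK jl addnC; apply.
rewrite /after_bound ltn_add2l ltnS.
by rewrite (big_rem j)//= leq_maxl.
Qed.

Let measurable_before_set l B i : (forall j, measurable (B j)) ->
  measurable (before_set l B i).
Proof.
by move=> mB; rewrite /before_set; case: insub => // j; case: ifP.
Qed.

Let measurable_after_set l B i : (forall j, measurable (B j)) ->
  measurable (after_set l B i).
Proof. by move=> mB; rewrite /after_set; case: ifP. Qed.

Lemma incr_before_law s C : measurable C ->
  P (incr_before s @^-1` C) = P (incr_before 0 @^-1` C).
Proof.
move=> mC; apply: path_law_unique mC => l B mB.
rewrite !(@incr_beforeE _ _ _ k)//.
by rewrite !incr_nat_box// => i; exact: measurable_before_set.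
Qed.

Lemma incr_after_law s C : measurable C ->
  P (incr_after s @^-1` C) = P (incr_after 0 @^-1` C).
Proof.
move=> mC; apply: path_law_unique mC => l B mB.
rewrite !incr_afterE.
by rewrite !incr_nat_box// => i; exact: measurable_after_set.
Qed.

(** An index below [k] is constrained only by the first event, any other only by the second, so the
    product over the grid splits factor by factor. *)
Lemma incr_before_after_indep s C D : measurable C -> measurable D ->
  P (incr_before s @^-1` C `&` incr_after s @^-1` D) =
  (P (incr_before s @^-1` C) * P (incr_after s @^-1` D))%E.
Proof.
move=> mC mD; apply: indep_paths mC mD => l B l' B' mB mB'.
have kn : (k <= after_bound l')%N by rewrite leq_addr.
rewrite (incr_beforeE _ _ _ kn) incr_afterE.
rewrite (_ : _ `&` _ = [set w | forall i, (i < after_bound l')%N ->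
    (before_set l B i `&` after_set l' B' i) (incr s i w)]); last first.
  apply/seteqP; split => w /=; first by move=> [H1 H2] i il; split; auto.
  by move=> H; split => i il; have [] := H i il.
have mb i := measurable_before_set l i mB.
have ma i := measurable_after_set l' i mB'.
have mab i := measurableI _ _ (mb i) (ma i).
rewrite (incr_nat_box s _ mab) (incr_nat_box s _ mb) (incr_nat_box s _ ma).
rewrite -big_split /=; apply: eq_bigr => i _.
rewrite /before_set; case: insubP => [j jk _|_]; last first.
  by rewrite setTI preimage_setT probability_setT mul1e.
rewrite /after_set leqNgt jk /=.
by rewrite setIT preimage_setT probability_setT mule1.
Qed.

End Grid.
End Increments.

Section PastFuture.
Context d (T : measurableType d) (R : realType) (P : probability T R).
Variables (X : R -> {RV P >-> R}) (levyX : levy_process X).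

(** With [i v] the grid index of -|v|, the increments from there up to position [k] telescope to the
    value at [v] of the past path; [after_sum] does the same from [k] on. *)
Let before_sum k (i : R -> nat) (x : pathspace R 'I_k) : pathspace R R :=
  fun v => \sum_(j < k) (if (i v <= j)%N then x j else 0 : R).

Let after_sum k (i : R -> nat) (x : pathspace R nat) : pathspace R R :=
  fun v => \sum_(0 <= j < i v - k) (x j : R).

Let measurable_before_sum k i : measurable_fun setT (@before_sum k i).
Proof.
apply: measurable_path => v.
by apply: measurable_sum => j; case: (i v <= j)%N => //; exact: measurable_coord.
Qed.

Let measurable_after_sum k i : measurable_fun setT (@after_sum k i).
Proof.
apply: measurable_path => v.
by apply: measurable_sum => j; exact: measurable_coord.
Qed.

Let past_boxE s (l : seq R) B (t : nat -> R) k (i : R -> nat) : t k = 0 ->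
  (forall v, v \in l -> (i v <= k)%N /\ t (i v) = - `|v|) ->
  past X s @^-1` box l B =
  incr_before X t s @^-1` (@before_sum k i @^-1` box l B).
Proof.
move=> tk il.
suff E w v : v \in l -> past X s w v = @before_sum k i (incr_before X t s w) v.
  by apply/seteqP; split => w H v vl; have := H v vl; rewrite E.
move=> vl; have [ik tv] := il v vl.
rewrite /before_sum /incr_before /incr -big_mkcond /=.
under eq_bigl do rewrite -[(_ <= _)%N]andTb.
rewrite -(big_geq_mkord _ _ xpredT (fun j => X (t j.+1 + s) w - X (t j + s) w)).
rewrite (telescope_sumr (fun j => X (t j + s) w))// tk tv add0r.
by rewrite [- _ + s]addrC.
Qed.

Let future_boxE s (l : seq R) B (t : nat -> R) k (i : R -> nat) : t k = 0 ->
  (forall v, v \in l -> (k <= i v)%N /\ t (i v) = `|v|) ->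
  future X s @^-1` box l B =
  incr_after X t k s @^-1` (@after_sum k i @^-1` box l B).
Proof.
move=> tk il.
suff E w v : v \in l -> future X s w v = after_sum k i (incr_after X t k s w) v.
  by apply/seteqP; split => w H v vl; have := H v vl; rewrite E.
move=> vl; have [ik tv] := il v vl.
rewrite /after_sum /incr_after /incr.
under eq_bigr do rewrite -addnS.
rewrite (telescope_sumr (fun j => X (t (k + j)%N + s) w))//.
by rewrite addn0 subnKC// tk tv add0r [_ + s]addrC.
Qed.

Let msum_box d1 (S1 : measurableType d1) (F : S1 -> pathspace R R) l B :
  measurable_fun setT F -> (forall v, measurable (B v)) ->
  measurable (F @^-1` box l B).
Proof.
move=> mF mB; rewrite -[X in measurable X]setTI; apply: mF => //.
exact: measurable_box.
Qed.

(** A box looks at finitely many times, for which an adapted grid exists; hence the reduction to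
    boxes precedes the choice of the grid. *)
Lemma past_law s C : measurable C -> P (past X s @^-1` C) = P (past X 0 @^-1` C).
Proof.
move=> mC; apply: path_law_unique mC => l B mB.
have [t [k [i [_ [t_nd tk il _]]]]] := time_grid l [::].
rewrite !(past_boxE _ _ tk il).
by apply: (incr_before_law levyX t_nd); exact: msum_box.
Qed.

Lemma future_law s C : measurable C ->
  P (future X s @^-1` C) = P (future X 0 @^-1` C).
Proof.
move=> mC; apply: path_law_unique mC => l B mB.
have [t [k [_ [i [t_nd tk _ il]]]]] := time_grid [::] l.
rewrite !(future_boxE _ _ tk il).
by apply: (incr_after_law levyX k t_nd); exact: msum_box.
Qed.

Lemma past_future_indep s C D : measurable C -> measurable D ->
  P (past X s @^-1` C `&` future X s @^-1` D) =
  (P (past X s @^-1` C) * P (future X s @^-1` D))%E.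
Proof.
move=> mC mD; apply: indep_paths mC mD => l B l' B' mB mB'.
have [t [k [i [i' [t_nd tk il il']]]]] := time_grid l l'.
rewrite (past_boxE _ _ tk il) (future_boxE _ _ tk il').
by apply: (incr_before_after_indep levyX t_nd); exact: msum_box.
Qed.

End PastFuture.

(** * Sample paths *)

Section Cadlag.
Context (R : realType).
Implicit Types f x : R -> R.

Lemma right_continuous_gt f (t a : R) : right_continuous f -> a < f t ->
  exists2 e, 0 < e & forall y, t <= y -> y < t + e -> a < f y.
Proof.
move=> cf aft.
have : \forall y \near t^'+, a < f y by apply: (cvgr_gt (f t)) => //; exact: cf.
rewrite near_withinE => /nbhs_ballP[e /= e0 He]; exists e => // y ty yte.
move: ty; rewrite le_eqVlt => /predU1P[<-//|ty]; apply: He => //=.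
by rewrite /ball /= ltr_distlC; apply/andP; split; lra.
Qed.

(** Right continuity bounds [f] to the right of [t], the left limit bounds it to the left. *)
Lemma cadlag_locally_bounded f (t : R) : cadlag f ->
  exists C, \forall y \near t, `|f y| <= C.
Proof.
move=> [rf lf]; have /cvg_ex[l fl] := lf t.
exists (`|f t| + `|l| + 1).
have Hr : \forall y \near t^'+, `|f y| <= `|f t| + 1.
  by apply: (cvgr_norm_le (f t)); [exact: rf|rewrite ltrDl].
have Hl : \forall y \near t^'-, `|f y| <= `|l| + 1.
  by apply: (cvgr_norm_le l); [exact: fl|rewrite ltrDl].
move: Hr Hl; rewrite !near_withinE => Hr Hl.
near=> y; have [yt|ty|->] := ltgtP y t.
- have : `|f y| <= `|l| + 1 by move: yt; near: y; exact: Hl.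
  by have := normr_ge0 (f t); lra.
- have : `|f y| <= `|f t| + 1 by move: ty; near: y; exact: Hr.
  by have := normr_ge0 l; lra.
- by have := normr_ge0 l; lra.
Unshelve. all: by end_near. Qed.

(** Compactness makes the local bounds uniform, as a property of all [C] near +oo. *)
Lemma cadlag_bounded f (a b : R) : cadlag f ->
  exists C, forall y, a <= y <= b -> `|f y| <= C.
Proof.
move=> cf; have /compact_near_coveringP := @segment_compact R a b.
move=> /(_ R +oo (fun C y => `|f y| <= C) _) [].
  move=> t _; have [C HC] := cadlag_locally_bounded t cf.
  near=> y D => /=; apply: (@le_trans _ _ C); first by near: y; exact: HC.
  by near: D; apply: nbhs_pinfty_ge; exact: num_real.
move=> C [_ HC]; exists (C + 1) => y yab.
by apply: (HC (C + 1)); rewrite ?ltrDl//= in_itv.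
Unshelve. all: by end_near. Qed.

End Cadlag.

(** * Suprema over rational times *)

Section RationalSup.
Context (R : realType).

(** A countable supremum preserves measurability in a parameter; extended values make unboundedness
    the event that it equals +oo. *)
Definition rat_sup (f : R -> R) : \bar R :=
  ereal_sup (range (fun q : rat => (f (ratr q))%:E)).

Lemma measurable_rat_sup d (S : measurableType d) (F : S -> R -> R) :
  (forall v, measurable_fun setT (F ^~ v)) ->
  measurable_fun setT (fun x => rat_sup (F x)).
Proof.
move=> mF; apply: (measurability _ (ErealGenOInfty.measurableE R)) => //.
move=> _ [_ [a ->] <-]; rewrite setTI.
rewrite (_ : _ @^-1` _ = \bigcup_(q : rat) ((F ^~ (ratr q)) @^-1` `]a, +oo[)).
  apply: bigcupT_measurable_rat => q; rewrite -[X in measurable X]setTI.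
  by apply: mF => //; exact: measurable_itv.
apply/seteqP; split => x /=.
  rewrite in_itv /= andbT => /ereal_sup_gt[_ [q _ <-]] aq; exists q => //=.
  by rewrite in_itv /= andbT -lte_fin.
move=> [q _]; rewrite /= !in_itv /= !andbT => aq.
apply: (@lt_le_trans _ _ (F x (ratr q))%:E); first by rewrite lte_fin.
by apply: ereal_sup_ubound; exists q.
Qed.

Definition rat_dense (f : R -> R) :=
  forall v a, a < f v -> exists q : rat, a < f (ratr q).

Lemma rat_supE f : rat_dense f -> rat_sup f = ereal_sup (EFin @` range f).
Proof.
move=> df; apply/eqP; rewrite eq_le; apply/andP; split.
  apply: ge_ereal_sup => _ [q _ <-]; apply: ereal_sup_ubound.
  by exists (f (ratr q)) => //; exists (ratr q).
apply: ge_ereal_sup => _ [_ [v _ <-] <-]; rewrite leNgt; apply/negP => lt.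
have [a aE] : exists a, (rat_sup f <= a%:E)%E /\ a < f v.
  case E : (rat_sup f) lt => [a| |] // lt; first by exists a; rewrite -lte_fin.
  by exists (f v - 1); rewrite leNye; split=> //; rewrite ltrBlDr ltrDl.
case: aE => sa /df[q]; apply/negP; rewrite -leNgt -lee_fin.
by apply: le_trans sa; apply: ereal_sup_ubound; exists q.
Qed.

(** Both [fine] of +oo and [sup] of a set unbounded above are 0 by convention. *)
Lemma fine_ereal_sup (A : set R) : A !=set0 ->
  fine (ereal_sup (EFin @` A)) = sup A.
Proof.
move=> A0; have [ubA|nubA] := pselect (has_ubound A).
  by rewrite ereal_sup_EFin.
rewrite hasNub_ereal_sup//= sup_out//.
by move=> [].
Qed.

Lemma fine_rat_sup f : rat_dense f -> fine (rat_sup f) = sup (range f).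
Proof.
by move=> df; rewrite rat_supE// fine_ereal_sup//; exists (f 0); exists 0.
Qed.

End RationalSup.

(** * Reflection at 0 of a single path *)

Section Reflection.
Context (R : realType).
Variable f : R -> R.
Hypothesis cf : cadlag f.

Definition rises (u : R) : set R := range (fun v : R => f u - f (u - `|v|)).

(** For t >= 0 the supremum of this set is minus the infimum over [0, t] of the increments after
    [u]; truncating |v| at [t] lets the whole line index [0, t]. *)
Definition drops (u t : R) : set R := range (fun v : R => f u - f (u + Num.min `|v| t)).

Lemma rises_imageE u : [set f u - f s | s in [set s | s <= u]] = rises u.
Proof.
apply/seteqP; split => _ [s /= su <-].
  by exists (u - s) => //; rewrite ger0_norm ?subr_ge0// subKr.
by exists (u - `|s|) => //=; rewrite gerBl.
Qed.

(** By right continuity the strict inequality persists slightly to the right of the time u - |v|,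
    that is, for rationals slightly below |v|. *)
Lemma rat_dense_rise u : rat_dense (fun v : R => f u - f (u - `|v|)).
Proof.
move=> v a; have [->|v0 av] := eqVneq v 0; first by exists 0; rewrite rmorph0.
have : f (u - `|v|) < f u - a by rewrite ltrBrDl -ltrBrDr.
rewrite -ltrN2 => /(@right_continuous_gt _ (fun x => - f x)) [].
  by move=> x; apply: cvgN; exact: cf.1.
move=> e e0 He; have v_gt0 : 0 < `|v| by rewrite normr_gt0.
have [q] : exists q, (ratr q : R) \in `](Num.max 0 (`|v| - e)), `|v|[.
  by apply: rat_in_itvoo; rewrite gt_max v_gt0 gtrBl.
rewrite in_itv /= gt_max -andbA => /and3P[q0 qe qv]; exists q.
rewrite (ger0_norm (ltW q0)).
by have := He (u - ratr q); rewrite ltrN2 => H; have := H _ _; lra.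
Qed.

(** For |v| < t a rational slightly above |v| works by right continuity; otherwise the truncation
    lets any rational above [t] reach the possibly irrational end point exactly. *)
Lemma rat_dense_drop (u t : R) : 0 <= t ->
  rat_dense (fun v : R => f u - f (u + Num.min `|v| t)).
Proof.
move=> t0 v a; have [vt|tv] := ltP `|v| t; last first.
  move=> av; have [q] : exists q, (ratr q : R) \in `]t, (t + 1)[.
    by apply: rat_in_itvoo; rewrite ltrDl.
  rewrite in_itv /= => /andP[tq _]; exists q.
  by rewrite (min_idPr _)//; apply: (le_trans (ltW tq)); exact: ler_norm.
move=> av.
have : - f (u + `|v|) > a - f u by lra.
move=> /(@right_continuous_gt _ (fun x => - f x)) [].
  by move=> x; apply: cvgN; exact: cf.1.
move=> e e0 He.
have [q] : exists q, (ratr q : R) \in `]`|v|, (Num.min t (`|v| + e))[.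
  by apply: rat_in_itvoo; rewrite lt_min vt ltrDl.
rewrite in_itv /= lt_min => /and3P[vq qt qe]; exists q.
have q0 : 0 <= ratr q :> R by apply: le_trans (ltW vq).
rewrite (ger0_norm q0) (min_idPl (ltW qt)).
by have := He (u + ratr q); lra.
Qed.

Lemma has_ubound_drops (u t : R) : 0 <= t -> has_ubound (drops u t).
Proof.
move=> t0; have [C HC] := cadlag_bounded u (u + t) cf.
exists (f u + C) => _ [v _ <-]; rewrite lerD2l.
have : `|f (u + Num.min `|v| t)| <= C.
  by apply: HC; rewrite lerDl le_min normr_ge0 t0 lerD2l ge_min lexx orbT.
by rewrite ler_norml => /andP[? _]; rewrite lerNl.
Qed.

Lemma drops_mem (u t v : R) : 0 <= v <= t -> drops u t (f u - f (u + v)).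
Proof.
move=> /andP[v0 vt]; exists v => //.
by rewrite (ger0_norm v0) (min_idPl vt).
Qed.

Lemma sup_drops_ge0 u t : 0 <= t -> 0 <= sup (drops u t).
Proof.
move=> t0; apply: ub_le_sup; first exact: has_ubound_drops.
by have := @drops_mem u t 0; rewrite addr0 subrr; apply; rewrite lexx.
Qed.

Lemma sup_drops_le (u s t : R) : 0 <= s -> s <= t -> sup (drops u s) <= sup (drops u t).
Proof.
move=> s0 st; apply: ge_sup; first by exists (f u - f (u + Num.min `|0 : R| s)), 0.
move=> _ [v _ <-]; apply: ub_le_sup; first exact: has_ubound_drops (le_trans s0 st).
by apply: drops_mem; rewrite le_min normr_ge0 s0 /= ge_min st orbT.
Qed.

Lemma sup_drops_final (u t : R) : 0 <= t -> 0 <= f (u + t) - f u + sup (drops u t).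
Proof.
move=> t0; have : f u - f (u + t) <= sup (drops u t).
  apply: ub_le_sup; first exact: has_ubound_drops.
  by apply: drops_mem; rewrite t0 /=.
by lra.
Qed.

(** The path is bounded on [u, u + t], so only the times before [u] decide; this makes boundedness a
    tail property. *)
Lemma has_ubound_rises (u t : R) : 0 <= t ->
  has_ubound (rises u) <-> has_ubound (rises (u + t)).
Proof.
move=> t0; split=> [[K HK]|[K HK]].
  exists (Num.max (f (u + t) - f u + K) (f (u + t) - f u + sup (drops u t))).
  move=> _ [v _ <-]; rewrite le_max.
  have [uv|vu] := leP (u + t - `|v|) u; apply/orP; [left|right].
    have : f u - f (u + t - `|v|) <= K.
      apply: HK; rewrite -rises_imageE; by exists (u + t - `|v|).
    lra.
  have : f u - f (u + (t - `|v|)) <= sup (drops u t).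
    apply: ub_le_sup; first exact: has_ubound_drops.
    by apply: drops_mem; rewrite gerBl; apply/andP; split=> //; lra.
  rewrite addrA; lra.
exists (f u - f (u + t) + K) => _ [v _ <-].
have : f (u + t) - f (u - `|v|) <= K.
  apply: HK; rewrite -rises_imageE; exists (u - `|v|) => //=.
  by have := normr_ge0 v; lra.
lra.
Qed.

(** Times s <= u contribute the increment plus [sup (rises u)], times in [u, u + t] the increment
    plus [sup (drops u t)]; the supremum is the larger one. The additive form isolates a term that
    depends only on the path after [u]. *)
Lemma reflection (u t : R) : 0 <= t -> has_ubound (rises u) ->
  sup (rises (u + t)) =
  f (u + t) - f u + sup (drops u t) + Num.max 0 (sup (rises u) - sup (drops u t)).
Proof.
move=> t0 ubu; have ubut := (has_ubound_rises u t0).1 ubu.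
rewrite addr_maxr addr0.
have -> : f (u + t) - f u + sup (drops u t) + (sup (rises u) - sup (drops u t)) =
          f (u + t) - f u + sup (rises u) by ring.
have rises0 s : rises s !=set0 by exists (f s - f (s - `|0 : R|)), 0.
have drops0 : drops u t !=set0 by exists (f u - f (u + Num.min `|0 : R| t)), 0.
apply/eqP; rewrite eq_le; apply/andP; split.
  apply: ge_sup => // _ [v _ <-]; rewrite le_max.
  have [uv|vu] := leP (u + t - `|v|) u; apply/orP; [right|left].
    have : f u - f (u + t - `|v|) <= sup (rises u).
      apply: ub_le_sup => //; rewrite -rises_imageE; by exists (u + t - `|v|).
    lra.
  have : f u - f (u + (t - `|v|)) <= sup (drops u t).
    apply: ub_le_sup; first exact: has_ubound_drops.
    by apply: drops_mem; rewrite gerBl; apply/andP; split=> //; lra.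
  rewrite addrA; lra.
rewrite ge_max; apply/andP; split; rewrite -lerBrDl; apply: ge_sup => //.
  move=> _ [v _ <-].
  have : f (u + t) - f (u + Num.min `|v| t) <= sup (rises (u + t)).
    apply: ub_le_sup => //; rewrite -rises_imageE.
    by exists (u + Num.min `|v| t) => //=; rewrite lerD2l ge_min lexx orbT.
  lra.
move=> _ [v _ <-].
have : f (u + t) - f (u - `|v|) <= sup (rises (u + t)).
  apply: ub_le_sup => //; rewrite -rises_imageE; exists (u - `|v|) => //=.
  by have := normr_ge0 v; lra.
lra.
Qed.

Lemma sup_rises_ge0 u : 0 <= sup (rises u).
Proof.
have [ubu|nub] := pselect (has_ubound (rises u)); last first.
  by rewrite sup_out// => -[].
by apply: ub_le_sup => //; exists 0 => //; rewrite normr0 subr0 subrr.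
Qed.

End Reflection.

(** * The stationary workload *)

Section Functionals.
Context (R : realType).

Definition path_workload (f : pathspace R R) : R := fine (rat_sup f).

Definition path_drop (t : R) (g : pathspace R R) : R :=
  fine (rat_sup (fun v => - (g (Num.min `|v| t) : R))).

Lemma measurable_path_rat_sup : measurable_fun setT (fun f : pathspace R R => rat_sup f).
Proof. by apply: measurable_rat_sup => v; exact: measurable_coord. Qed.

Lemma measurable_path_workload : measurable_fun setT path_workload.
Proof. exact: measurableT_comp measurable_path_rat_sup. Qed.

Lemma measurable_path_drop t : measurable_fun setT (path_drop t).
Proof.
apply: measurableT_comp => //; apply: measurable_rat_sup => v.
by apply: measurableT_comp => //; exact: measurable_coord.
Qed.

Definition unbounded_paths : set (pathspace R R) := [set f | rat_sup f = +oo%E].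

Lemma measurable_unbounded_paths : measurable unbounded_paths.
Proof.
rewrite (_ : unbounded_paths = (fun f : pathspace R R => rat_sup f) @^-1` [set +oo%E])//.
rewrite -[X in measurable X]setTI.
by apply: measurable_path_rat_sup => //; exact: emeasurable_set1.
Qed.

End Functionals.

Section Workload.
Context d (T : measurableType d) (R : realType) (P : probability T R).
Variables (X : R -> {RV P >-> R}) (levyX : levy_process X).

Let trajectory (w : T) : R -> R := fun t => X t w.

Let cX w : cadlag (trajectory w) := levy_cadlag levyX w.

Lemma workloadE t w : workload X t w = path_workload (past X t w).
Proof.
rewrite /workload (rises_imageE (trajectory w) t) /path_workload.
rewrite fine_rat_sup//; exact: (rat_dense_rise (cX w)).
Qed.

Lemma workload_supE t w : workload X t w = sup (rises (trajectory w) t).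
Proof. by rewrite /workload (rises_imageE (trajectory w) t). Qed.

Lemma path_drop_future u t w : 0 <= t ->
  path_drop t (future X u w) = sup (drops (trajectory w) u t).
Proof.
move=> t0; rewrite /path_drop -fine_rat_sup; last exact: (rat_dense_drop (cX w)).
congr (fine (rat_sup _)); apply/funext => v; rewrite /future opprB.
by rewrite [ `|Num.min _ _| ]ger0_norm// le_min normr_ge0.
Qed.

Lemma measurable_workload t : measurable_fun setT (workload X t).
Proof.
rewrite (_ : workload X t = @path_workload R \o past X t).
  by apply: measurableT_comp; [exact: measurable_path_workload|exact: measurable_past].
by apply/funext => w; rewrite workloadE.
Qed.

Lemma workload_ge0 t w : 0 <= workload X t w.
Proof. by rewrite workload_supE; exact: sup_rises_ge0. Qed.

Lemma past_unboundedP t w :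
  (past X t @^-1` @unbounded_paths R) w <-> ~ has_ubound (rises (trajectory w) t).
Proof.
have rises0 : rises (trajectory w) t !=set0.
  by exists (trajectory w t - trajectory w (t - `|0 : R|)), 0.
rewrite /preimage /= /unbounded_paths /= rat_supE; last exact: (rat_dense_rise (cX w)).
split=> [+ ub|nub]; last exact: hasNub_ereal_sup.
by rewrite ereal_sup_EFin.
Qed.

Lemma past_unboundedE s t :
  past X s @^-1` @unbounded_paths R = past X t @^-1` @unbounded_paths R.
Proof.
wlog st : s t / s <= t.
  by move=> H; have [/H//|/ltW/H] := leP s t.
have -> : t = s + (t - s) by ring.
apply/seteqP; split => w; rewrite !past_unboundedP;
  by rewrite -(has_ubound_rises (cX w) s) ?subr_ge0.
Qed.

Lemma measurable_past_unbounded t :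
  measurable (past X t @^-1` @unbounded_paths R).
Proof. by apply: measurable_funPTI; exact: measurable_unbounded_paths. Qed.

(* An event on the past up to time -n is independent of the increments over
   [-n, 0]; unboundedness is such an event for every n, hence it is independent
   of itself. *)
Lemma past_unbounded_01 (U := past X 0 @^-1` @unbounded_paths R) :
  P U = 0%E \/ P U = 1%E.
Proof.
have mU : measurable U := measurable_past_unbounded 0.
suff : (P U = P U * P U)%E.
  have [p ->] : exists p, P U = p%:E.
    by exists (fine (P U)); rewrite fineK// fin_num_measure.
  rewrite -EFinM => -[] pp.
  have /eqP : p * (1 - p) = 0 by rewrite mulrBr mulr1 -pp subrr.
  by rewrite mulf_eq0 subr_eq0 => /orP[/eqP ->|/eqP <-]; [left|right].
rewrite -{1}(setIid U).
apply: (@indep_path_event _ _ _ P R (past X 0) U mU _ _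
  (@measurable_unbounded_paths R)) => l B mB.
(* Bounds the times seen by the box, which is thus an event on the increments over [-n, 0]. *)
pose n := \big[Num.max/0]_(v <- l) `|v|.
have ln v : v \in l -> `|v| <= n by move=> vl; rewrite /n; exact: le_bigmax_seq.
(* Reads X_0 - X_(-|v|) off the increments [g] after time -n, as g(n) - g(n - |v|). *)
pose D : set (pathspace R R) :=
  (fun g : pathspace R R => (fun v => (g n : R) - g (n - `|v|)) : pathspace R R)
    @^-1` box l B.
have mD : measurable D.
  rewrite -[D]setTI; apply: (measurable_path (T := pathspace R R)) => //.
    by move=> v; apply: measurable_funB; exact: measurable_coord.
  exact: measurable_box.
have -> : past X 0 @^-1` box l B = future X (- n) @^-1` D.
  apply/seteqP; split => w H v vl; have := H v vl; have vn := ln v vl;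
  rewrite /past /future;
  have n0 := le_trans (normr_ge0 v) vn;
  rewrite (ger0_norm n0) (@ger0_norm _ (n - `|v|)) ?subr_ge0//;
  by rewrite addNr addrA addNr !add0r opprB addrA subrK.
rewrite /U (past_unboundedE 0 (- n)) setIC muleC.
by apply: (past_future_indep levyX) => //; exact: measurable_unbounded_paths.
Qed.

Lemma past_unbounded_null :
  (0 < 'V_P[workload X 0])%E -> P (past X 0 @^-1` @unbounded_paths R) = 0%E.
Proof.
have mU := measurable_past_unbounded 0.
case: past_unbounded_01 => // U1; rewrite lt_neqAle eq_sym => /andP[/eqP V0 _].
exfalso; apply: V0.
(* [sup] defaults to 0 on sets unbounded above, so almost sure unboundedness forces a zero workload
   and hence a zero variance. *)
have Q0 : {ae P, forall w, workload X 0 w = 0}.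
  exists (~` (past X 0 @^-1` @unbounded_paths R)); split.
  - exact: measurableC.
  - by rewrite probability_setC// U1 subee.
  - move=> w /= Q0 /past_unboundedP nub; apply: Q0.
    by rewrite workload_supE sup_out// => -[].
have E0 : ('E_P[workload X 0] = 0)%E.
  rewrite unlock; transitivity (\int[P]_w (cst 0%E w : \bar R))%E.
    apply: ae_eq_integral => //; first exact/measurable_EFinP/measurable_workload.
    by apply: filterS Q0 => w -> _.
  by rewrite integral_cst// mul0e.
rewrite /variance unlock E0 /= unlock.
transitivity (\int[P]_w (cst 0%E w : \bar R))%E; last by rewrite integral_cst// mul0e.
apply: ae_eq_integral => //.
  apply/measurable_EFinP; apply: measurable_funM; apply: measurable_funB => //;
  exact: measurable_workload.
by apply: filterS Q0 => w /= + _; rewrite !fctE /= => ->; rewrite subrr mulr0.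
Qed.

End Workload.

(** * Rearrangement *)

Section Rearrangement.
Context d (T : measurableType d) (R : realType) (P : probability T R).
Variables Y Z : T -> R.
Hypotheses (mY : measurable_fun setT Y) (mZ : measurable_fun setT Z).
Hypotheses (Y0 : forall w, 0 <= Y w) (Z0 : forall w, 0 <= Z w).
Hypothesis YZ_law : forall h : R -> \bar R, measurable_fun setT h ->
  (forall x, (0 <= h x)%E) -> (\int[P]_w h (Z w) = \int[P]_w h (Y w))%E.
Hypothesis Y2 : (\int[P]_w (Y w ^+ 2)%:E < +oo)%E.

(* Young's inequality: with G convex, D its derivative and K = x D - G the
   Legendre transform of G at D, one has Y D(Z) <= G(Y) + K(Z), with equality
   when Y = Z; since Y and Z have the same law, so have K(Y) and K(Z). *)
Lemma rearrangement (D G : R -> R) :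
  measurable_fun setT D -> measurable_fun setT G -> (forall x, 0 <= D x) ->
  (forall x y, 0 <= x -> 0 <= y -> D y * (x - y) <= G x - G y) ->
  (forall x, 0 <= x -> 0 <= x * D x - G x <= x ^+ 2) ->
  (\int[P]_w (Y w * D (Z w))%:E <= \int[P]_w (Y w * D (Y w))%:E)%E.
Proof.
(* Cut at 0 so that [K] is nonnegative on the whole line, as [YZ_law] demands; for x >= 0 the cut
   does nothing. *)
move=> mD mG D0 GD DK; pose K x := Num.max 0 (x * D x - G x).
have KE x : 0 <= x -> K x = x * D x - G x.
  by move=> x0; rewrite /K (max_idPr _)//; have /andP[] := DK x x0.
have K0 x : 0 <= K x by rewrite le_max lexx.
have mK : measurable_fun setT K.
  by apply: measurable_maxr => //; apply: measurable_funB => //; exact: measurable_funM.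
have mDY : measurable_fun setT (fun w => Y w * D (Y w)).
  by apply: measurable_funM => //; exact: measurableT_comp.
have mDZ : measurable_fun setT (fun w => Y w * D (Z w)).
  by apply: measurable_funM => //; exact: measurableT_comp.
have mKY : measurable_fun setT (K \o Y) by exact: measurableT_comp.
have mKZ : measurable_fun setT (K \o Z) by exact: measurableT_comp.
have KYfin : (\int[P]_w (K (Y w))%:E)%E \is a fin_num.
  rewrite ge0_fin_numE; last by apply: integral_ge0 => w _; rewrite lee_fin.
  apply: le_lt_trans Y2; apply: ge0_le_integral => //.
  - by move=> w _; rewrite lee_fin.
  - exact/measurable_EFinP.
  - by apply/measurable_EFinP; exact: measurable_funX.
  - by move=> w _; rewrite lee_fin KE//; have /andP[] := DK _ (Y0 w).
(* The finite integral of K(Y) is added to both sides and turned into that of K(Z) on the right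
   only; what remains holds pointwise, by the tangent inequality [GD]. *)
rewrite -(leeD2rE _ _ KYfin).
rewrite -[X in (_ <= _ + X)%E](@YZ_law (EFin \o K)) /=; last 2 first.
- exact/measurable_EFinP.
- by move=> x; rewrite lee_fin.
rewrite -!ge0_integralD//=;
  try (by move=> w _; rewrite lee_fin ?mulr_ge0);
  try exact/measurable_EFinP.
apply: ge0_le_integral => //.
- by move=> w _; rewrite -EFinD lee_fin addr_ge0 ?mulr_ge0.
- by apply/measurable_EFinP; apply: measurable_funD.
- by apply/measurable_EFinP; apply: measurable_funD.
- move=> w _; rewrite -!EFinD lee_fin !KE//.
  by have := GD _ _ (Y0 w) (Z0 w); nra.
Qed.

End Rearrangement.

(** * The functions (x - m)^+ and their differences *)

Section HockeyStick.
Context (R : realType).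

Definition excess (m x : R) : R := Num.max 0 (x - m).

Lemma excess_ge0 m x : 0 <= excess m x.
Proof. by rewrite le_max lexx. Qed.

Lemma measurable_excess m : measurable_fun setT (excess m).
Proof. by apply: measurable_maxr => //; exact: measurable_funB. Qed.

Lemma excess_nondecreasing m x y : 0 <= (x - y) * (excess m x - excess m y).
Proof.
have := sqr_ge0 (x - y); rewrite /excess.
by have [?|?] := leP 0 (x - m); have [?|?] := leP 0 (y - m); nra.
Qed.

(** [excess m] is the derivative of the convex function [excess m x ^+ 2 / 2]. *)
Lemma excess_tangent m x y :
  excess m y * (x - y) <= excess m x ^+ 2 / 2 - excess m y ^+ 2 / 2.
Proof.
have := sqr_ge0 (x - y); rewrite /excess.
by have [?|?] := leP 0 (x - m); have [?|?] := leP 0 (y - m); nra.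
Qed.

(** The middle term is (x^2 - m^2) / 2 above [m] and 0 below. *)
Lemma excess_legendre m x : 0 <= m -> 0 <= x ->
  0 <= x * excess m x - excess m x ^+ 2 / 2 <= x ^+ 2.
Proof.
by rewrite /excess; have [?|?] := leP 0 (x - m) => ? ?; apply/andP; split; nra.
Qed.

Lemma excess_antitone m m' x : m <= m' -> excess m' x <= excess m x.
Proof. by move=> mm; rewrite /excess ge_max !le_max lexx /= lerB ?orbT. Qed.

(** The difference has slope 1 on [m, m'] and 0 elsewhere, so it is nondecreasing and again the
    derivative of a convex function. *)
Lemma excess_diff_tangent m m' x y : m <= m' ->
  (excess m y - excess m' y) * (x - y) <=
  (excess m x ^+ 2 / 2 - excess m' x ^+ 2 / 2) -
  (excess m y ^+ 2 / 2 - excess m' y ^+ 2 / 2).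
Proof.
have := sqr_ge0 (x - y); have := sqr_ge0 (x - m); have := sqr_ge0 (x - m').
rewrite /excess => ? ? ? mm.
have [?|?] := leP 0 (x - m); have [?|?] := leP 0 (y - m);
have [?|?] := leP 0 (x - m'); have [?|?] := leP 0 (y - m'); nra.
Qed.

Lemma excess_diff_legendre m m' x : 0 <= m -> m <= m' -> 0 <= x ->
  0 <= x * (excess m x - excess m' x) -
    (excess m x ^+ 2 / 2 - excess m' x ^+ 2 / 2) <= x ^+ 2.
Proof.
rewrite /excess; have [?|?] := leP 0 (x - m); have [?|?] := leP 0 (x - m');
  by move=> ? ? ?; apply/andP; split; nra.
Qed.

End HockeyStick.

Section ExcessMoments.
Context d (T : measurableType d) (R : realType) (P : probability T R).
Variables Y Z : T -> R.
Hypotheses (mY : measurable_fun setT Y) (mZ : measurable_fun setT Z).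
Hypotheses (Y0 : forall w, 0 <= Y w) (Z0 : forall w, 0 <= Z w).
Hypothesis YZ_law : forall h : R -> \bar R, measurable_fun setT h ->
  (forall x, (0 <= h x)%E) -> (\int[P]_w h (Z w) = \int[P]_w h (Y w))%E.
Hypothesis Y2 : (\int[P]_w (Y w ^+ 2)%:E < +oo)%E.

(** [a] and [m] are frozen values of A and M; [Y] stands for Q_0, and [V] for Q_0 or Q_u. *)
Let moment (V : T -> R) (a m : R) : \bar R :=
  (\int[P]_w (Y w * (a + excess m (V w)))%:E)%E.

Let mexcess (V : T -> R) m : measurable_fun setT V ->
  measurable_fun setT (fun w => excess m (V w) : R).
Proof. by move=> mV; apply: measurableT_comp => //; exact: measurable_excess. Qed.

Lemma moment_le a m : 0 <= a -> 0 <= m -> (moment Z a m <= moment Y a m)%E.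
Proof.
move=> a0 m0.
have split (V : T -> R) : measurable_fun setT V -> (forall w, 0 <= V w) ->
  moment V a m = (\int[P]_w (Y w * a)%:E + \int[P]_w (Y w * excess m (V w))%:E)%E.
  move=> mV V0; rewrite -ge0_integralD//=.
  - by apply: eq_integral => w _; rewrite -EFinD mulrDr.
  - by move=> w _; rewrite lee_fin mulr_ge0.
  - by apply/measurable_EFinP; exact: measurable_funM.
  - by move=> w _; rewrite lee_fin mulr_ge0 ?excess_ge0.
  - by apply/measurable_EFinP; apply: measurable_funM => //; exact: mexcess.
rewrite !split//; apply: leeD2l.
apply: (rearrangement mY mZ Y0 Z0 YZ_law Y2 (G := fun x => excess m x ^+ 2 / 2)).
- exact: measurable_excess.
- by apply: measurable_funM => //; apply: measurable_funX; exact: measurable_excess.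
- by move=> x; exact: excess_ge0.
- by move=> x y _ _; exact: excess_tangent.
- by move=> x x0; exact: excess_legendre.
Qed.

Lemma moment_exchange a a' m m' : 0 <= a -> 0 <= a' -> 0 <= m -> m <= m' ->
  (moment Z a m + moment Y a' m' <= moment Y a m + moment Z a' m')%E.
Proof.
move=> a0 a'0 m0 mm'.
pose D x := excess m x - excess m' x.
have D0 x : 0 <= D x by rewrite subr_ge0 excess_antitone.
have mD : measurable_fun setT D by apply: measurable_funB; exact: measurable_excess.
(* The part shared by both sides, split off as a summand so that all integrands stay nonnegative. *)
pose base := (\int[P]_w (Y w * (a + a' + excess m' (Y w) + excess m' (Z w)))%:E)%E.
have split (U V : T -> R) : measurable_fun setT U -> measurable_fun setT V ->
  (forall w, Y w * (a + excess m (U w)) + Y w * (a' + excess m' (V w)) =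
     Y w * (a + a' + excess m' (Y w) + excess m' (Z w)) + Y w * D (U w)) ->
  (moment U a m + moment V a' m' = base + \int[P]_w (Y w * D (U w))%:E)%E.
  move=> mU mV UV; rewrite -!ge0_integralD//=.
  - by apply: eq_integral => w _; rewrite -!EFinD UV.
  - by move=> w _; rewrite lee_fin mulr_ge0// !addr_ge0 ?excess_ge0.
  - apply/measurable_EFinP; apply: measurable_funM => //.
    by do 2![apply: measurable_funD; last exact: mexcess].
  - by move=> w _; rewrite lee_fin mulr_ge0.
  - by apply/measurable_EFinP; apply: measurable_funM => //; exact: measurableT_comp.
  - by move=> w _; rewrite lee_fin mulr_ge0// addr_ge0 ?excess_ge0.
  - apply/measurable_EFinP; apply: measurable_funM => //.
    by apply: measurable_funD => //; exact: mexcess.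
  - by move=> w _; rewrite lee_fin mulr_ge0// addr_ge0 ?excess_ge0.
  - apply/measurable_EFinP; apply: measurable_funM => //.
    by apply: measurable_funD => //; exact: mexcess.
rewrite (split Z Y)// ?(split Y Z)//; try by move=> w; rewrite /D; ring.
apply: leeD2l.
apply: (rearrangement mY mZ Y0 Z0 YZ_law Y2
  (G := fun x => excess m x ^+ 2 / 2 - excess m' x ^+ 2 / 2)) => //.
- apply: measurable_funB; apply: measurable_funM => //; apply: measurable_funX;
  exact: measurable_excess.
- by move=> x y _ _; exact: excess_diff_tangent.
- by move=> x x0; exact: excess_diff_legendre.
Qed.

(* Chebyshev's association inequality, from the pointwise inequality
   (Y - b) (excess m Y - excess m b) >= 0 with b the mean of Y. *)
Lemma moment_ge_product a m (b : R) : 0 <= a -> (\int[P]_w (Y w)%:E = b%:E)%E ->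
  (b%:E * \int[P]_w (a + excess m (Y w))%:E <= moment Y a m)%E.
Proof.
move=> a0 Yb.
have b0 : 0 <= b by rewrite -lee_fin -Yb; apply: integral_ge0 => w _; rewrite lee_fin.
pose e := a + excess m b.
have e0 : 0 <= e by rewrite addr_ge0 ?excess_ge0.
have me : measurable_fun setT (fun w => a + excess m (Y w)).
  by apply: measurable_funD => //; exact: mexcess.
have ae0 w : 0 <= a + excess m (Y w) by rewrite addr_ge0 ?excess_ge0.
have E1 : (\int[P]_w (Y w * e)%:E = (b * e)%:E)%E.
  under eq_integral do rewrite EFinM muleC.
  rewrite ge0_integralZl//; last 2 first.
  - exact/measurable_EFinP.
  - by move=> w _; rewrite lee_fin.
  by rewrite Yb muleC EFinM.
have E2 : (\int[P]_w (cst (b * e) w)%:E = (b * e)%:E)%E.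
  by rewrite /= integral_cst//= probability_setT mule1.
(* Adding [b * e] to both sides, once as the integral of [Y w * e] and once as that of a constant,
   leaves a pointwise inequality between nonnegative terms. *)
rewrite -(leeD2rE _ _ (_ : (b * e)%:E \is a fin_num))// -{1}E1 -E2.
rewrite -ge0_integralZl//=; last 2 first.
- exact/measurable_EFinP.
- by move=> w _; rewrite lee_fin.
rewrite -!ge0_integralD//=.
- apply: ge0_le_integral => //.
  + by move=> w _; rewrite -EFinM -EFinD lee_fin addr_ge0 ?mulr_ge0.
  + apply: emeasurable_funD; last by apply/measurable_EFinP; exact: measurable_funM.
    by under eq_fun do rewrite -EFinM; apply/measurable_EFinP; exact: measurable_funM.
  + by apply: emeasurable_funD => //; apply/measurable_EFinP; exact: measurable_funM.
  + move=> w _; rewrite -EFinM -!EFinD lee_fin /e.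
    by have := excess_nondecreasing m (Y w) b; nra.
- by move=> w _; rewrite lee_fin mulr_ge0.
- by apply/measurable_EFinP; exact: measurable_funM.
- by move=> w _; rewrite lee_fin mulr_ge0.
- by move=> w _; rewrite -EFinM lee_fin mulr_ge0.
- by under eq_fun do rewrite -EFinM; apply/measurable_EFinP; exact: measurable_funM.
- by move=> w _; rewrite lee_fin mulr_ge0.
- by apply/measurable_EFinP; exact: measurable_funM.
Qed.

End ExcessMoments.

(** * Decomposition of the mixed moments *)

Section Decomposition.
Context d (T : measurableType d) (R : realType) (P : probability T R).
Variables (X : R -> {RV P >-> R}) (levyX : levy_process X).

Lemma ge0_integral_law d' (S : measurableType d') (Y Z : {mfun T >-> S})
    (F : S -> \bar R) :
  (forall C, measurable C -> P (Y @^-1` C) = P (Z @^-1` C)) ->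
  measurable_fun setT F -> (forall x, 0 <= F x)%E ->
  (\int[P]_w F (Y w) = \int[P]_w F (Z w))%E.
Proof.
move=> YZ mF F0.
transitivity (\int[distribution P Y]_x F x)%E.
  by rewrite ge0_integral_distribution.
rewrite (eq_measure_integral (distribution P Z)); last first.
  by move=> C mC _; exact: YZ.
by rewrite ge0_integral_distribution.
Qed.

Lemma integral_workload_law (h : R -> \bar R) t :
  measurable_fun setT h -> (forall x, 0 <= h x)%E ->
  (\int[P]_w h (workload X t w) = \int[P]_w h (workload X 0 w))%E.
Proof.
move=> mh h0.
under eq_integral do rewrite (workloadE levyX).
under [RHS]eq_integral do rewrite (workloadE levyX).
apply: (@ge0_integral_law _ _ (past X t) (past X 0) (h \o @path_workload R)) => //.
  by move=> C; exact: (past_law levyX).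
  by apply: measurableT_comp => //; exact: measurable_path_workload.
by move=> f; exact: h0.
Qed.

(** The term A. For t >= 0 the cut at 0 is inactive on paths of [X]; it makes the functional
    nonnegative on all of path space. *)
Definition path_net (t : R) (g : pathspace R R) : R :=
  Num.max 0 ((g t : R) + path_drop t g).

Lemma measurable_path_net t : measurable_fun setT (path_net t).
Proof.
apply: measurable_maxr => //; apply: measurable_funD.
  exact: measurable_coord.
exact: measurable_path_drop.
Qed.

Lemma path_net_ge0 t g : 0 <= path_net t g.
Proof. by rewrite le_max lexx. Qed.

Lemma workload_future u t w : 0 <= t ->
  ~ (past X 0 @^-1` @unbounded_paths R) w ->
  workload X (u + t) w = path_net t (future X u w) +
    excess (path_drop t (future X u w)) (workload X u w).
Proof.
move=> t0; rewrite (past_unboundedE levyX 0 u) (past_unboundedP levyX).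
move=> /contrapT ubu.
have cX := levy_cadlag levyX w.
rewrite !workload_supE (reflection cX t0 ubu) (path_drop_future levyX)//.
congr (_ + _); rewrite /path_net (path_drop_future levyX)// /future ger0_norm//.
by rewrite (max_idPr _)//; exact: (sup_drops_final cX).
Qed.

(** [W] is a weight that depends on the past of [u]: it will be Q_0 read off that past, or the
    constant 1. *)
Let weighted (W : pathspace R R -> R) (t : R)
    (z : pathspace R R * pathspace R R) : \bar R :=
  (W z.1 * (path_net t z.2 + excess (path_drop t z.2) (path_workload z.1)))%:E.

Let measurable_weighted (W : pathspace R R -> R) t : measurable_fun setT W ->
  measurable_fun setT (weighted W t).
Proof.
move=> mW; apply/measurable_EFinP; apply: measurable_funM.
  exact: measurableT_comp.
apply: measurable_funD.
  by apply: measurableT_comp => //; exact: measurable_path_net.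
apply: measurable_maxr => //; apply: measurable_funB.
  by apply: measurableT_comp => //; exact: measurable_path_workload.
by apply: measurableT_comp => //; exact: measurable_path_drop.
Qed.

Let weighted_ge0 (W : pathspace R R -> R) t :
  (forall f, 0 <= W f) -> forall z, (0 <= weighted W t z)%E.
Proof.
by move=> W0 z; rewrite lee_fin mulr_ge0// addr_ge0 ?path_net_ge0 ?excess_ge0.
Qed.

Let weighted_workload W u t w w' :
  weighted W t (past X u w, future X 0 w') =
  (W (past X u w) * (path_net t (future X 0 w') +
     excess (path_drop t (future X 0 w')) (workload X u w)))%:E.
Proof. by rewrite (workloadE levyX). Qed.

Lemma measurable_decomposition (W : pathspace R R -> R) u t :
  measurable_fun setT W -> (forall f, 0 <= W f) ->
  measurable_fun setT (fun w' => \int[P]_w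
    (W (past X u w) * (path_net t (future X 0 w') +
       excess (path_drop t (future X 0 w')) (workload X u w)))%:E)%E.
Proof.
move=> mW W0.
have /measurableT_comp/(_ (measurable_future X 0)) :=
  measurable_partial_integral P (past X u) (measurable_weighted t mW)
    (weighted_ge0 t W0).
by under [_ \o _]eq_fun => w' do under eq_integral => w _ do rewrite weighted_workload.
Qed.

(** Independence of past and future at [u] gives the iterated integral; the future at [u] is then
    replaced by that at 0, which has the same law, so that the pair (A, M) no longer depends on
    [u]. *)
Lemma workload_decomposition (W : pathspace R R -> R) u t :
  measurable_fun setT W -> (forall f, 0 <= W f) -> 0 <= t ->
  P (past X 0 @^-1` @unbounded_paths R) = 0%E ->
  (\int[P]_w (W (past X u w) * workload X (u + t) w)%:E =
   \int[P]_w' \int[P]_w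
    (W (past X u w) * (path_net t (future X 0 w') +
       excess (path_drop t (future X 0 w')) (workload X u w)))%:E)%E.
Proof.
move=> mW W0 t0 PU.
transitivity (\int[P]_w weighted W t (past X u w, future X u w))%E.
  (* The recursion [workload_future] can fail only on the null event of unbounded paths. *)
  apply: ae_eq_integral => //.
  - apply/measurable_EFinP; apply: measurable_funM.
      by apply: measurableT_comp => //; exact: measurable_past.
    exact: (measurable_workload levyX).
  - apply: measurableT_comp; first exact: measurable_weighted.
    by apply: measurable_fun_pair; [exact: measurable_past|exact: measurable_future].
  exists (past X 0 @^-1` @unbounded_paths R); split => //.
    exact: (measurable_past_unbounded X).
  move=> w /= H; apply: contrapT => nU; apply: H => _; congr (_%:E).
  by rewrite /weighted /= workload_future// (workloadE levyX).
rewrite (indep_fubini (measurable_weighted t mW) (weighted_ge0 t W0)); last first.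
  by move=> C D mC mD; exact: (past_future_indep levyX).
transitivity (\int[P]_w' \int[P]_w weighted W t (past X u w, future X 0 w'))%E.
  apply: (@ge0_integral_law _ _ (future X u) (future X 0)
    (fun g => \int[P]_w weighted W t (past X u w, g))%E).
  - by move=> C; exact: (future_law levyX).
  - exact: measurable_partial_integral (measurable_weighted t mW) (weighted_ge0 t W0).
  - by move=> g; apply: integral_ge0 => w _; exact: weighted_ge0.
by under eq_integral => w' _ do under eq_integral => w _ do rewrite weighted_workload.
Qed.

End Decomposition.

(** * Convexity from decreasing increments *)

Section DecreasingIncrements.
Context (R : realType).
Variable c : R -> R.
Hypothesis c_dec : forall s t, 0 <= s -> s <= t -> c t <= c s.
Hypothesis c_incr : forall u s t, 0 <= u -> 0 <= s -> s <= t ->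
  c (u + s) + c t <= c s + c (u + t).

(** Each of the [n] steps of length [h] after [y] decreases [c] by at most as much as the first
    one. *)
Let forward (y h : R) n : 0 <= y -> 0 <= h ->
  c y - c (y + n%:R * h) <= n%:R * (c y - c (y + h)).
Proof.
move=> y0 h0; elim: n => [|n IH]; first by rewrite !mul0r addr0 subrr.
have nh : 0 <= n%:R * h by rewrite mulr_ge0.
have := c_incr h0 y0 (_ : y <= y + n%:R * h); rewrite lerDl nh => /(_ isT).
rewrite (_ : y + n.+1%:R * h = h + (y + n%:R * h)); last by rewrite -natr1; ring.
rewrite (_ : h + y = y + h); last by ring.
rewrite -natr1; lra.
Qed.

(** Each of the [n] steps before [y] decreases [c] by at least as much as the step after [y]. *)
Let backward (y h : R) n : 0 <= h -> n%:R * h <= y ->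
  n%:R * (c y - c (y + h)) <= c (y - n%:R * h) - c y.
Proof.
move=> h0; elim: n => [|n IH]; first by rewrite !mul0r subr0 subrr.
rewrite -natr1 => ny.
have nh : 0 <= n%:R * h by rewrite mulr_ge0.
have := IH (_ : n%:R * h <= y); rewrite (_ : n%:R * h <= y); last by lra.
move=> /(_ isT).
have s0 : 0 <= y - (n%:R + 1) * h by lra.
have := c_incr h0 s0 (_ : _ <= y).
rewrite (_ : y - (n%:R + 1) * h <= y); last by lra.
move=> /(_ isT).
rewrite (_ : h + (y - (n%:R + 1) * h) = y - n%:R * h); last by ring.
rewrite (_ : h + y = y + h); last by ring.
lra.
Qed.

(* Compare both increments with the smallest step [c y - c (y + h)], where
   [h = (z - y) / N]; the rounding error of [(y - x) / h] vanishes as N grows. *)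
Lemma decreasing_increments_slope (x y z : R) : 0 <= x -> x <= y -> y < z ->
  (y - x) * (c y - c z) <= (z - y) * (c x - c y).
Proof.
move=> x0 xy yz; have y0 : 0 <= y by lra.
have step N : (y - x) * (c y - c z) - (z - y) * (c x - c y) <=
              (z - y) * (c y - c z) / N.+1%:R.
  pose h := (z - y) / N.+1%:R.
  have N0 : 0 < N.+1%:R :> R by rewrite ltr0n.
  have h0 : 0 < h by rewrite divr_gt0 ?subr_gt0.
  have Nh : N.+1%:R * h = z - y by rewrite /h mulrC divfK// gt_eqF.
  pose n := Num.truncn ((y - x) / h).
  have q0 : 0 <= (y - x) / h by rewrite divr_ge0 ?subr_ge0// ltW.
  have /andP[nq qn] := truncn_itv q0; rewrite -/n in nq qn.
  have nh : n%:R * h <= y - x by rewrite -ler_pdivlMr.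
  have nh' : y - x < n%:R * h + h.
    by move: qn; rewrite ltr_pdivrMr// -natr1 mulrDl mul1r.
  have F := @forward y h N.+1 y0 (ltW h0).
  rewrite Nh (addrC y) subrK in F.
  have B := @backward y h n (ltW h0) (_ : _ <= y).
  rewrite (_ : n%:R * h <= y) in B; last by lra.
  have {}B := B isT.
  have xn : c (y - n%:R * h) <= c x by apply: c_dec; lra.
  have D : 0 <= c y - c z by rewrite subr_ge0; apply: c_dec; lra.
  have n0 : 0 <= n%:R :> R by [].
  have {}B : n%:R * (c y - c (y + h)) <= c x - c y by lra.
  rewrite ler_pdivlMr// -Nh.
  have : n%:R * (c y - c z) <= N.+1%:R * (c x - c y).
    apply: (@le_trans _ _ (n%:R * (N.+1%:R * (c y - c (y + h))))).
      by rewrite ler_wpM2l.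
    by rewrite mulrCA ler_wpM2l// ltW.
  move=> /(ler_wpM2l (ltW h0)) E.
  have E2 : (y - x) * (c y - c z) <= (n%:R * h + h) * (c y - c z).
    by rewrite ler_wpM2r// ltW.
  have : ((y - x) * (c y - c z) - N.+1%:R * h * (c x - c y)) <= h * (c y - c z).
    by lra.
  move=> /(ler_wpM2r (ltW N0)) /le_trans; apply.
  by rewrite le_eqVlt; apply/orP; left; apply/eqP; ring.
set A := _ - _ in step; set K := (z - y) * (c y - c z) in step.
rewrite -subr_le0 -/A leNgt; apply/negP => A0.
have K0 : 0 <= K.
  by rewrite mulr_ge0 ?subr_ge0 ?(ltW yz)//; apply: c_dec; lra.
(* Archimedean choice of N: K / A < N + 1 contradicts A <= K / (N + 1). *)
have := step (Num.truncn (K / A)).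
rewrite ler_pdivlMr ?ltr0n// leNgt => /negP; apply.
rewrite -ltr_pdivrMl// mulrC.
by have /andP[] := truncn_itv (divr_ge0 K0 (ltW A0)).
Qed.

(** This is the slope inequality at the intermediate point [z], divided by y - x; exchanging the end
    points replaces [l] by 1 - l. *)
Lemma decreasing_increments_convex (x y l : R) : 0 <= x -> 0 <= y ->
  0 <= l <= 1 -> c (l * x + (1 - l) * y) <= l * c x + (1 - l) * c y.
Proof.
wlog xy : x y l / x <= y.
  move=> H x0 y0 l01; have [xy|/ltW yx] := leP x y; first exact: H.
  have := H y x (1 - l) yx y0 x0; rewrite subKr.
  by rewrite (addrC (_ * y)) (addrC (_ * c y)); apply; lra.
move=> x0 y0 /andP[l0 l1].
have [->|lt_xy] := eqVneq x y; first by rewrite -!mulrDl subrKC !mul1r.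
have {lt_xy}xy' : x < y by rewrite lt_neqAle lt_xy.
set z := l * x + _; have zE : z = y - l * (y - x) by rewrite /z; ring.
have [l_0|l_neq0] := eqVneq l 0; first by rewrite zE l_0 !mul0r !subr0 mul1r add0r.
have l_gt0 : 0 < l by rewrite lt_neqAle eq_sym l_neq0.
have zy : z < y by rewrite zE gtrBl mulr_gt0 ?subr_gt0.
have xz : x <= z by rewrite zE; nra.
have := decreasing_increments_slope x0 xz zy.
rewrite (_ : z - x = (1 - l) * (y - x)); last by rewrite zE; ring.
rewrite (_ : y - z = l * (y - x)); last by rewrite zE; ring.
rewrite ![_ * (y - x)]mulrC -!mulrA ler_pM2l ?subr_gt0//.
lra.
Qed.

End DecreasingIncrements.

(** * The correlation function *)

Lemma ge0_dominated_Lfun1 d (T : measurableType d) (R : realType)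
    (P : probability T R) (f g : T -> R) :
  measurable_fun setT f -> measurable_fun setT g -> (forall w, 0 <= f w <= g w) ->
  (\int[P]_w (g w)%:E < +oo)%E -> f \in Lfun P 1.
Proof.
move=> mf mg fg gy; apply/Lfun1_integrable/integrableP; split.
  exact/measurable_EFinP.
apply: le_lt_trans gy; apply: ge0_le_integral => //.
- by apply: measurableT_comp => //; exact/measurable_EFinP.
- exact/measurable_EFinP.
- by move=> w _; have /andP[f0 fgw] := fg w; rewrite lee_fin ger0_norm.
Qed.

Lemma ge0_le_integral_add d (T : measurableType d) (R : realType)
    (mu : {measure set T -> \bar R}) (f g f' g' : T -> \bar R) :
  measurable_fun setT f -> measurable_fun setT g ->
  measurable_fun setT f' -> measurable_fun setT g' ->
  (forall x, 0 <= f x)%E -> (forall x, 0 <= g x)%E ->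
  (forall x, 0 <= f' x)%E -> (forall x, 0 <= g' x)%E ->
  (forall x, f x + g x <= f' x + g' x)%E ->
  (\int[mu]_x f x + \int[mu]_x g x <= \int[mu]_x f' x + \int[mu]_x g' x)%E.
Proof.
move=> mf mg mf' mg' f0 g0 f'0 g'0 fg.
rewrite -!ge0_integralD//; apply: ge0_le_integral => //.
- by move=> x _; exact: adde_ge0.
- exact: emeasurable_funD.
- exact: emeasurable_funD.
Qed.

(** * Covariances of the stationary workload *)

Section Autocovariance.
Context d (T : measurableType d) (R : realType) (P : probability T R).
Variables (X : R -> {RV P >-> R}) (levyX : levy_process X).
Hypothesis var_pos : (0 < 'V_P[workload X 0%R])%E.
Hypothesis var_fin : ('V_P[workload X 0%R] < +oo)%E.

Let Q := workload X.

Let mQ t : measurable_fun setT (Q t) := measurable_workload levyX t.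

Let Q0 t w : 0 <= Q t w := workload_ge0 X t w.

Let PU : P (past X 0 @^-1` @unbounded_paths R) = 0%E :=
  past_unbounded_null levyX var_pos.

Let Q_law u (h : R -> \bar R) : measurable_fun setT h -> (forall x, 0 <= h x)%E ->
  (\int[P]_w h (Q u w) = \int[P]_w h (Q 0 w))%E.
Proof. exact: integral_workload_law. Qed.

Let Q_sqr : (\int[P]_w (Q 0 w ^+ 2)%:E < +oo)%E.
Proof.
(* By definition the variance integrates the squared distance to this [b], even before the mean is
   known to be finite; Q^2 <= 2 V + 2 b^2 because (Q - 2 b)^2 >= 0. *)
pose b := fine ('E_P[Q 0]); pose V w := (Q 0 w - b) * (Q 0 w - b).
have mV : measurable_fun setT V by apply: measurable_funM; exact: measurable_funB.
have V0 w : 0 <= V w by rewrite /V -expr2 sqr_ge0.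
have VE : ('V_P[Q 0] = \int[P]_w (V w)%:E)%E by rewrite /variance unlock -/b unlock.
apply: (@le_lt_trans _ _ (\int[P]_w (V w + V w + (cst (2 * b ^+ 2) w))%:E)%E).
  apply: ge0_le_integral => //.
  - by move=> w _; rewrite lee_fin sqr_ge0.
  - by apply/measurable_EFinP; exact: measurable_funX.
  - by apply/measurable_EFinP; do 2![apply: measurable_funD => //].
  - by move=> w _; rewrite lee_fin /V /=; have := sqr_ge0 (Q 0 w - 2 * b); lra.
under eq_integral do rewrite EFinD EFinD.
have mVE := (measurable_EFinP _ _).2 mV.
have VE0 w : [set: T] w -> (0 <= (V w)%:E)%E by move=> _; rewrite lee_fin.
have VV0 w : [set: T] w -> (0 <= (V w)%:E + (V w)%:E)%E.
  by move=> _; rewrite -EFinD lee_fin addr_ge0.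
have b0 w : [set: T] w -> (0 <= (cst (2 * b ^+ 2) w)%:E)%E.
  by move=> _; rewrite lee_fin mulr_ge0// sqr_ge0.
rewrite (ge0_integralD _ _ VV0 (emeasurable_funD mVE mVE) b0)//=.
rewrite ge0_integralD// -VE integral_cst//= probability_setT mule1.
by rewrite !lte_add_pinfty// ltry.
Qed.

Let Q_sqr_law t : (\int[P]_w (Q t w ^+ 2)%:E = \int[P]_w (Q 0 w ^+ 2)%:E)%E.
Proof.
apply: (Q_law t (h := fun x => (x ^+ 2)%:E)).
- by apply/measurable_EFinP; exact: measurable_funX.
- by move=> x; rewrite lee_fin sqr_ge0.
Qed.

Definition cross_moment (t : R) : \bar R :=
  (\int[P]_w (Q 0 w * Q t w)%:E)%E.

Let Q_Lfun1 t : Q t \in Lfun P 1.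
Proof.
apply: (@ge0_dominated_Lfun1 _ _ _ _ _ (fun w => 1 + Q t w ^+ 2)) => //.
- by apply: measurable_funD => //; exact: measurable_funX.
- by move=> w; rewrite Q0 /=; have := Q0 t w; nra.
under eq_integral do rewrite EFinD.
rewrite ge0_integralD//=; last 2 first.
- by move=> w _; rewrite lee_fin sqr_ge0.
- by apply/measurable_EFinP; exact: measurable_funX.
by rewrite Q_sqr_law integral_cst//= probability_setT mule1 lte_add_pinfty// ltry.
Qed.

Let QQ_Lfun1 s t : (Q s \* Q t) \in Lfun P 1.
Proof.
apply: (@ge0_dominated_Lfun1 _ _ _ _ _ (fun w => Q s w ^+ 2 + Q t w ^+ 2)) => //.
- exact: measurable_funM.
- by apply: measurable_funD; exact: measurable_funX.
- by move=> w; rewrite mulr_ge0 //=; have := sqr_ge0 (Q s w - Q t w);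
    have := Q0 s w; have := Q0 t w; nra.
under eq_integral do rewrite EFinD.
rewrite ge0_integralD//=;
  try (by move=> w _; rewrite lee_fin sqr_ge0);
  try (by apply/measurable_EFinP; exact: measurable_funX).
by rewrite !Q_sqr_law lte_add_pinfty.
Qed.

Let b := fine ('E_P[Q 0]).

Let Q_mean t : ('E_P[Q t] = b%:E)%E.
Proof.
rewrite /b fineK; last exact: expectation_fin_num.
rewrite unlock; apply/esym.
have absE s : (\int[P]_w (Q s w)%:E = \int[P]_w (`|Q s w|)%:E)%E.
  by apply: eq_integral => w _; rewrite ger0_norm// Q0.
rewrite !absE; apply/esym/(Q_law t (h := fun x => (`|x|)%:E)).
  by apply/measurable_EFinP; exact: normr_measurable.
by move=> x; rewrite lee_fin.
Qed.

Let Q_int t : (\int[P]_w (Q t w)%:E = b%:E)%E.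
Proof. by rewrite -(Q_mean t) unlock. Qed.

Let cross_fin t : cross_moment t \is a fin_num.
Proof. by apply: integrable_fin_num => //; exact/Lfun1_integrable/QQ_Lfun1. Qed.

Let c t := fine (cross_moment t).

Let cE t : cross_moment t = (c t)%:E.
Proof. by rewrite /c fineK. Qed.

Let covariance_workload t : covariance P (Q 0) (Q t) = (c t - b * b)%:E.
Proof.
rewrite covarianceE ?Q_Lfun1 ?QQ_Lfun1// !Q_mean EFinB -EFinM /c fineK//.
by rewrite unlock.
Qed.

Let variance_workload t : 'V_P[Q t]%E = (c 0 - b * b)%:E.
Proof.
rewrite /variance covarianceE ?Q_Lfun1 ?QQ_Lfun1// !Q_mean EFinB -EFinM /c fineK//.
by congr (_ - _)%E; rewrite unlock; exact: Q_sqr_law.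
Qed.

(** For u >= 0, Q_0 is a functional of the past of [u]: the values of that past at u + |v| and at
    [u] differ by X_0 - X_(-|v|). The absolute value makes nonnegativity immediate. *)
Let weight u (f : pathspace R R) : R :=
  `|path_workload (fun v => (f (u + `|v|) : R) - f u)|.

Let measurable_weight u : measurable_fun setT (weight u).
Proof.
apply: (measurableT_comp (@normr_measurable R setT)).
apply: (measurableT_comp (@measurable_path_workload R)).
apply: measurable_path => v.
by apply: measurable_funB; exact: measurable_coord.
Qed.

Let weightE u w : 0 <= u -> weight u (past X u w) = Q 0 w.
Proof.
move=> u0; rewrite /weight /Q (_ : (fun v => _) = past X 0 w); last first.
  apply/funext => v; rewrite /past (ger0_norm u0).
  rewrite ger0_norm; last by rewrite addr_ge0.
  rewrite opprD !addrA subrr sub0r; ring.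
by rewrite -(workloadE levyX) ger0_norm// Q0.
Qed.

Let net t w := path_net t (future X 0 w).
Let drop t w := path_drop t (future X 0 w).

Let net_ge0 t w : 0 <= net t w. Proof. exact: path_net_ge0. Qed.

Let drop_ge0 t w : 0 <= t -> 0 <= drop t w.
Proof.
by move=> t0; rewrite /drop (path_drop_future levyX)//; apply: sup_drops_ge0;
  [exact: levy_cadlag levyX w|].
Qed.

Let drop_le s t w : 0 <= s -> s <= t -> drop s w <= drop t w.
Proof.
move=> s0 st; rewrite /drop !(path_drop_future levyX) ?(le_trans s0)//.
by apply: sup_drops_le => //; exact: levy_cadlag levyX w.
Qed.

Let moment u a m : \bar R := (\int[P]_w (Q 0 w * (a + excess m (Q u w)))%:E)%E.

Let moment_ge0 u a m : 0 <= a -> (0 <= moment u a m)%E.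
Proof.
move=> a0; apply: integral_ge0 => w _.
by rewrite lee_fin mulr_ge0// addr_ge0 ?excess_ge0.
Qed.

Let measurable_moment u t : 0 <= u ->
  measurable_fun setT (fun w => moment u (net t w) (drop t w)).
Proof.
move=> u0.
have := measurable_decomposition levyX u t (@measurable_weight u) (fun f => normr_ge0 _).
by under eq_fun => w' do under eq_integral => w _ do rewrite weightE//.
Qed.

(** The cross moments at lags [t] and [u + t] become integrals over the same pair (A, M) and differ
    only in having Q_0 or Q_u inside [moment]. *)
Let cross_momentE u t : 0 <= u -> 0 <= t ->
  cross_moment (u + t) = (\int[P]_w moment u (net t w) (drop t w))%E.
Proof.
move=> u0 t0.
have := workload_decomposition levyX u (@measurable_weight u)
  (fun f => normr_ge0 _) t0 PU.
under eq_integral => w _ do rewrite weightE//.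
by under [X in _ = X -> _]eq_integral => w' _ do
  under eq_integral => w _ do rewrite weightE//.
Qed.

Let cross_moment0E t : 0 <= t ->
  cross_moment t = (\int[P]_w moment 0 (net t w) (drop t w))%E.
Proof. by move=> t0; have := cross_momentE (lexx 0) t0; rewrite add0r. Qed.

(** With u = t - s, both cross moments are integrals over the pair (A, M) for time [s], compared
    pointwise by [moment_le]. *)
Let c_nonincreasing s t : 0 <= s -> s <= t -> c t <= c s.
Proof.
move=> s0 st; rewrite -lee_fin -!cE.
have u0 : 0 <= t - s by rewrite subr_ge0.
have := cross_momentE u0 s0; rewrite subrK => ->; rewrite (cross_moment0E s0).
apply: ge0_le_integral; first exact: measurableT.
- by move=> w _; apply: moment_ge0; exact: net_ge0.
- exact: measurable_moment u0.
- exact: measurable_moment (lexx 0).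
- move=> w _; apply: (moment_le (mQ 0) (mQ _) (Q0 0) (Q0 _) (@Q_law _) Q_sqr).
    exact: net_ge0.
  exact: drop_ge0.
Qed.

(** As [drop] is nondecreasing in time, [moment_exchange] applies to each frozen future. *)
Let c_increments u s t : 0 <= u -> 0 <= s -> s <= t ->
  c (u + s) + c t <= c s + c (u + t).
Proof.
move=> u0 s0 st; have t0 := le_trans s0 st.
rewrite -lee_fin !EFinD -!cE.
rewrite (cross_momentE u0 s0) (cross_momentE u0 t0).
rewrite (cross_moment0E s0) (cross_moment0E t0).
apply: ge0_le_integral_add;
  try (by move=> w; apply: moment_ge0; exact: net_ge0);
  try (by apply: measurable_moment; first [exact: lexx|exact: u0]).
move=> w; apply: (moment_exchange (mQ 0) (mQ u) (Q0 0) (Q0 u) (@Q_law u) Q_sqr).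
- exact: net_ge0.
- exact: net_ge0.
- exact: drop_ge0.
- exact: drop_le.
Qed.

(** Chebyshev's inequality is applied to each frozen future and then integrated. *)
Let c_ge_sqr_mean t : 0 <= t -> b * b <= c t.
Proof.
move=> t0; rewrite -lee_fin -cE (cross_moment0E t0).
(* The mean of Q_t for a frozen future; by the decomposition with weight 1 it integrates to [b]. *)
pose L w' := (\int[P]_w (net t w' + excess (drop t w') (Q 0 w))%:E)%E.
have L0 w : (0 <= L w)%E.
  by apply: integral_ge0 => w' _; rewrite lee_fin addr_ge0 ?excess_ge0.
have one1 : measurable_fun setT (fun _ : pathspace R R => 1 : R) by [].
have one0 (f : pathspace R R) : 0 <= 1 :> R by [].
have mL : measurable_fun setT L.
  have := measurable_decomposition levyX 0 t one1 one0.
  by under eq_fun => w' do under eq_integral => w _ do rewrite mul1r.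
have LE : (\int[P]_w L w = b%:E)%E.
  rewrite -(Q_int (0 + t)); have := workload_decomposition levyX 0 one1 one0 t0 PU.
  under eq_integral => w _ do rewrite mul1r.
  move=> ->; apply: eq_integral => w' _.
  by apply: eq_integral => w _; rewrite mul1r.
have b0 : (0 <= b%:E)%E.
  by rewrite -(Q_int 0); apply: integral_ge0 => w _; rewrite lee_fin.
rewrite EFinM -{2}LE -ge0_integralZl//.
apply: ge0_le_integral => //.
- by move=> w _; exact: mule_ge0.
- by apply: measurable_funeM.
- exact: measurable_moment.
- by move=> w _; apply: (moment_ge_product (mQ 0) (Q0 0)).
Qed.

(** The [c] provided here is the covariance, that is, the cross moment minus the squared mean; by
    stationarity the normalization is the constant variance [v]. *)
Lemma workload_autocovariance : exists (c : R -> R) (v : R),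
  [/\ 0 < v,
      forall t, correlation P (workload X 0) (workload X t) = c t / v,
      forall t, 0 <= t -> 0 <= c t,
      forall s t, 0 <= s -> s <= t -> c t <= c s &
      forall u s t, 0 <= u -> 0 <= s -> s <= t ->
        c (u + s) + c t <= c s + c (u + t)].
Proof.
have v0 : 0 < c 0 - b * b.
  by move: var_pos; rewrite -/(Q 0) variance_workload lte_fin.
exists (fun t => c t - b * b), (c 0 - b * b); split; first exact: v0.
- move=> t; rewrite /correlation -/(Q 0) -/(Q t) covariance_workload.
  by rewrite !variance_workload /= -expr2 sqrtr_sqr gtr0_norm.
- by move=> t t0; rewrite subr_ge0 c_ge_sqr_mean.
- by move=> s t s0 st; rewrite lerD2r c_nonincreasing.
- by move=> u s t u0 s0 st; rewrite addrACA [leRHS]addrACA lerD2r c_increments.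
Qed.

End Autocovariance.

Theorem theorem1 (d : measure_display) (T : measurableType d) (R : realType)
    (P : probability T R) (X : R -> {RV P >-> R})
    (levyX : levy_process X)
    (mean_exists : P.-integrable setT (EFin \o (X 1%R)^\+))
    (mean_neg : ('E_P[X 1%R] < 0)%E)
    (var_pos : (0 < 'V_P[workload X 0%R])%E)
    (var_fin : ('V_P[workload X 0%R] < +oo)%E) :
  let r := fun t : R => correlation P (workload X 0) (workload X t) in
  [/\ {in `[0, +oo[, forall t, 0 <= r t},
      {in `[0, +oo[ &, {homo r : s t / s <= t >-> t <= s}} &
      convex_function (`[0, +oo[%classic : set R^o) r].
Proof.
have [c [v [v0 rE c0 c_dec c_incr]]] := workload_autocovariance levyX var_pos var_fin.
move=> r; have rc t : r t = c t / v := rE t.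
split.
- by move=> t; rewrite in_itv /= andbT rc => t0; rewrite divr_ge0 ?c0// ltW.
- move=> s t; rewrite !in_itv /= !andbT !rc => s0 _ st.
  by rewrite ler_pM2r ?invr_gt0// c_dec.
- move=> l x y; rewrite !inE /= !in_itv /= !andbT => x0 y0; rewrite !convRE !rc.
  have l01 : 0 <= l%:num <= 1 by rewrite ge0 le1.
  have := decreasing_increments_convex c_dec c_incr x0 y0 l01.
  rewrite -(ler_pM2r (_ : 0 < v^-1)) ?invr_gt0// => /le_trans; apply.
  by rewrite mulrDl !mulrA.
Qed.
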